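(* For every $c>0$ there exists $\epsilon>0$ such that the following holds. Let $n\ge 1$ and let $\sigma\in\{0,1\}^n$ be written as $\sigma=\sigma_1\sigma_2\cdots\sigma_m$, where each $\sigma_i$ is either $0^{L_i}$ or $1^{L_i}$, each $L_i$ is chosen maximal (so $\sigma_1,\dots,\sigma_m$ are the maximal runs of equal bits of $\sigma$), and $m\ge cn$. Let $\alpha\in\mathbb{Z}_{2^n-1}$ have base-$2$ representation $\sigma$. Then $\alpha$ has the $\epsilon$-shifting property, i.e. $\left|M\cup(\alpha+M)\right|\ge\left(\tfrac12+\epsilon\right)2^n$.
   Context: Elements of $\mathbb{Z}_{2^n-1}$ are identified with $n$-bit binary strings via their base-$2$ representations (most significant bit first). For a bit string $x$, $wt(x)$ denotes its Hamming weight. $M=\{x : wt(x)\le \frac n2\}$ is the set of ''light'' strings, and $\alpha+M=\{\alpha+x : x\in M\}$ with addition in $\mathbb{Z}_{2^n-1}$. An element $\alpha$ is said to have the $\epsilon$-shifting property if $|M\cup(\alpha+M)|\ge(\frac12+\epsilon)2^n$.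
   Formalization: The union M ∪ (α+M) is counted as a set of n-bit strings, where both 0^n and 1^n represent 0, so 1^n is counted when 0 ∈ α+M; counting residues would make the claim false for n=1 (and for odd n ≤ 1/c with α=0). *)

(* Defs.v *)
From HB Require Import structures.
From mathcomp Require Import all_boot all_order all_algebra.
From mathcomp Require Import reals.

Set Implicit Arguments.
Unset Strict Implicit.
Unset Printing Implicit Defensive.

Import Order.TTheory GRing.Theory Num.Theory.

(* Z_{2^n-1}, with the additive group structure that zmodp.v puts on 'I_p.+1.
   The modulus (2 ^ n - 2).+1 equals 2 ^ n - 1 for every n >= 1, including
   n = 1 (the trivial group), where 'Z_(2 ^ n - 1) would be Z/2. *)
Notation Zmers n := ('I_(2 ^ n - 2).+1).

Definition bits_val (s : seq bool) : nat :=
  foldl (fun v (b : bool) => v.*2 + b) 0 s.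

(* The identification of n-bit strings with elements of Z_{2^n-1}. It is
   injective except that 0^n and 1^n both represent 0. *)
Definition residue n (x : n.-tuple bool) : Zmers n := inZp (bits_val x).

Definition wt (s : seq bool) : nat := count id s.

Definition light n : {set n.-tuple bool} := [set x : n.-tuple bool | (wt x).*2 <= n].

(* alpha + A, as the set of all n-bit strings representing some alpha + x. *)
Definition shift n (alpha : Zmers n) (A : {set n.-tuple bool}) :
    {set n.-tuple bool} :=
  @residue n @^-1: [set (alpha + residue x)%R | x in A].

Definition shifting_property (R : realType) (eps : R) n (alpha : Zmers n) : Prop :=
  ((2^-1 + eps) * 2 ^+ n <= #|light n :|: shift alpha (light n)|%:R)%R.

(* r = [:: (b_1, L_1); ...; (b_m, L_m)] encodes s = b_1^{L_1} ... b_m^{L_m}.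
   The L_i are maximal exactly when neighbouring blocks carry different bits. *)
Definition maximal_runs (s : seq bool) (r : seq (bool * nat)) : Prop :=
  [/\ s = flatten [seq nseq p.2 p.1 | p <- r],
      all (fun p => 0 < p.2) r
    & sorted (fun p q => p.1 != q.1) r].

(* Main.v *)
(* Addition of [alpha] is realised by a bijection [T] of bit strings (binary
   addition with end-around carry), and it suffices that a positive fraction of
   the light strings [x] have [T x] heavy.
   At a position [i] with [sigma_i <> sigma_(i+1)], if [x_(i+1) = sigma_(i+1)]
   then the carry into position [i] is [sigma_(i+1)], so [(T x)_i = ~~ x_i]; if
   moreover [x_(i-1) <> x_i], exchanging these two bits fixes the weight of [x]
   and changes [T x] in position [i] only.  Let [s_i = 0, 1, -1] be the
   resulting decrease of the weight of [T x].  Choosing the positions [i] in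
   one class modulo 3 makes the exchanges independent.
   Tilt the uniform measure by the density [prod_i (1 + theta s_i)] with
   [theta] of order [n^(-1/2)].  The law of the weight of [x] is unchanged, so
   [x] is light with probability at least 1/2, whereas the weight of [T x]
   acquires a drift of order [theta n], several standard deviations; hence
   [x] light and [T x] heavy has tilted probability at least 1/4.  The density
   is bounded in [L^2], so by Cauchy-Schwarz the uniform probability is bounded
   below as well. *)
Require Import Defs.
From HB Require Import structures.
From mathcomp Require Import all_boot all_order all_algebra.
From mathcomp Require Import ring lra zify.
From mathcomp Require Import reals sequences exp.

Set Implicit Arguments.
Unset Strict Implicit.
Unset Printing Implicit Defensive.

Import Order.TTheory GRing.Theory Num.Theory.
Local Open Scope ring_scope.

Section FiniteSums.
Variables (R : realFieldType) (X : finType).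

Lemma sqr_sum_le_card (B : {set X}) (f : X -> R) :
  (\sum_(x in B) f x) ^+ 2 <= #|B|%:R * \sum_(x in B) f x ^+ 2.
Proof.
have [->|[y By]] := set_0Vmem B; first by rewrite !big_set0 expr0n mulr0.
have B_gt0 : 0 < #|B|%:R :> R by rewrite ltr0n; apply/card_gt0P; exists y.
set S := \sum_(x in B) f x; set k : R := #|B|%:R in B_gt0 *.
suff sum_sqr : \sum_(x in B) (k * f x - S) ^+ 2 =
    k * (k * \sum_(x in B) f x ^+ 2 - S ^+ 2).
  rewrite -subr_ge0 -(pmulr_rge0 _ B_gt0) -sum_sqr.
  by apply: sumr_ge0 => x _; apply: sqr_ge0.
transitivity (k ^+ 2 * (\sum_(x in B) f x ^+ 2) - 2 * k * S * S + S ^+ 2 * k).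
  rewrite mulr_sumr [2 * k * S * S]mulr_sumr [S ^+ 2 * k]mulr_natr -sumr_const.
  by rewrite -sumrB -big_split; apply: eq_bigr => x _ /=; ring.
by ring.
Qed.

Lemma sum_weighted_sqr_orthogonal (I : eqType) (r : seq I) (w : X -> R)
    (f : I -> X -> R) :
  uniq r ->
  {in r &, forall i j, i != j -> \sum_x w x * (f i x * f j x) = 0} ->
  \sum_x w x * (\sum_(i <- r) f i x) ^+ 2 =
  \sum_(i <- r) \sum_x w x * f i x ^+ 2.
Proof.
move=> r_uniq orth.
under eq_bigr do rewrite expr2 mulr_suml mulr_sumr.
rewrite exchange_big /= !big_seq; apply: eq_bigr => i ir.
under eq_bigr do rewrite !mulr_sumr.
rewrite exchange_big /= (bigD1_seq i) //= [X in _ + X]big_seq_cond.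
rewrite [X in _ + X]big1 ?addr0 //.
by move=> j /andP[jr ji]; apply: orth => //; rewrite eq_sym.
Qed.

Section Involution.
Variable f : X -> X.
Hypothesis fK : involutive f.

Lemma sum_odd_involutive (F : X -> R) :
  (forall x, F (f x) = - F x) -> \sum_x F x = 0.
Proof.
move=> F_odd; have : \sum_x F x = - \sum_x F x; last by lra.
rewrite [LHS](reindex_inj (inv_inj fK)) -sumrN.
by apply: eq_bigr => x _; rewrite F_odd.
Qed.

Lemma sum_symmetrize (s F : X -> R) (g : R -> R) :
  (forall x, s (f x) = - s x) -> (forall x, F (f x) = F x) ->
  \sum_x g (s x) * F x = \sum_x (g (s x) + g (- s x)) / 2 * F x.
Proof.
move=> s_odd F_inv; apply/eqP; rewrite -subr_eq0 -sumrB; apply/eqP.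
by apply: sum_odd_involutive => x; rewrite s_odd F_inv opprK; field.
Qed.

Lemma sum_indicator_half (b : pred X) (F : X -> R) :
  (forall x, b (f x) = ~~ b x) -> (forall x, F (f x) = F x) ->
  \sum_x (b x)%:R * F x = 2^-1 * \sum_x F x.
Proof.
move=> b_neg F_inv; apply/eqP; rewrite mulr_sumr -subr_eq0 -sumrB; apply/eqP.
apply: sum_odd_involutive => x; rewrite b_neg F_inv.
by case: (b x) => /=; field.
Qed.

End Involution.
End FiniteSums.

(** * Tilting along independent sign-reversing involutions *)

Section ProductTilt.
Variables (R : realFieldType) (X : finType) (I : eqType).

Record independent_reversals (r : seq I) (phi : I -> X -> X)
    (s : I -> X -> R) : Prop := IndependentReversals {
  reversals_uniq : uniq r;
  reversalK : {in r, forall i, involutive (phi i)};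
  reversal_sign_opp : {in r, forall i x, s i (phi i x) = - s i x};
  reversal_indep : {in r &, forall i j x, j != i -> s j (phi i x) = s j x};
  reversal_sign_le1 : {in r, forall i x, `|s i x| <= 1}
}.

Variables (r : seq I) (phi : I -> X -> X) (s : I -> X -> R).
Hypothesis indep : independent_reversals r phi s.

Lemma reversal_sign_sqr_le1 i x : i \in r -> s i x ^+ 2 <= 1.
Proof.
move=> ir; rewrite -real_normK ?num_real // expr_le1 //.
exact: (reversal_sign_le1 indep).
Qed.

Lemma reversal_sign_sqr i j x :
  i \in r -> j \in r -> s j (phi i x) ^+ 2 = s j x ^+ 2.
Proof.
move=> ir jr; have [->|ji] := eqVneq j i.
  by rewrite (reversal_sign_opp indep) // sqrrN.
by rewrite (reversal_indep indep).
Qed.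

Lemma prod_reversal_indep (g : R -> R) (q : seq I) i x :
  i \in r -> {subset q <= r} -> i \notin q ->
  \prod_(j <- q) g (s j (phi i x)) = \prod_(j <- q) g (s j x).
Proof.
move=> ir qr iq; apply: eq_big_seq => j jq.
have ji : j != i by apply: contraNneq iq => <-.
by rewrite (reversal_indep indep ir (qr _ jq)).
Qed.

Lemma sum_prod_symmetrize (g : R -> R) (q : seq I) (F : X -> R) :
  uniq q -> {subset q <= r} -> {in q, forall i x, F (phi i x) = F x} ->
  \sum_x (\prod_(i <- q) g (s i x)) * F x =
  \sum_x (\prod_(i <- q) ((g (s i x) + g (- s i x)) / 2)) * F x.
Proof.
elim: q F => [|i q IH] F /=.
  by move=> _ _ _; apply: eq_bigr => x _; rewrite !big_nil.
move=> /andP[iq q_uniq] sub F_inv.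
have ir : i \in r by apply: sub; rewrite mem_head.
have qr : {subset q <= r} by move=> j jq; apply: sub; rewrite inE jq orbT.
pose rest x := (\prod_(j <- q) g (s j x)) * F x.
have rest_inv x : rest (phi i x) = rest x.
  by rewrite /rest F_inv ?mem_head // prod_reversal_indep.
transitivity (\sum_x g (s i x) * rest x).
  by apply: eq_bigr => x _; rewrite big_cons mulrA.
rewrite (sum_symmetrize (reversalK indep ir) g (reversal_sign_opp indep ir)) //.
transitivity (\sum_x (\prod_(j <- q) g (s j x)) *
    ((g (s i x) + g (- s i x)) / 2 * F x)).
  by apply: eq_bigr => x _; rewrite mulrCA.
rewrite IH // => [|j jq x].
  by apply: eq_bigr => x _; rewrite big_cons mulrCA mulrA.
have ij : i != j by apply: contraNneq iq => ->.
by rewrite F_inv ?inE ?jq ?orbT // (reversal_indep indep (qr _ jq) ir).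
Qed.

Variable theta : R.

Definition tilt (x : X) : R := \prod_(i <- r) (1 + theta * s i x).

Lemma sum_tilt_invariant (F : X -> R) :
  {in r, forall i x, F (phi i x) = F x} ->
  \sum_x tilt x * F x = \sum_x F x.
Proof.
move=> F_inv; rewrite (sum_prod_symmetrize (fun t => 1 + theta * t)) //.
  by apply: eq_bigr => x _; rewrite big1 ?mul1r // => i _; field.
exact: reversals_uniq indep.
Qed.

Lemma sum_tilt : \sum_x tilt x = #|X|%:R.
Proof.
under eq_bigr do rewrite -[tilt _]mulr1.
by rewrite sum_tilt_invariant // sumr_const.
Qed.

Lemma sum_tilt_sign i (F : X -> R) : i \in r ->
  (forall x, F (phi i x) = F x) ->
  \sum_x tilt x * (s i x * F x) = theta * \sum_x tilt x * (s i x ^+ 2 * F x).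
Proof.
move=> ir F_inv; have r_uniq := reversals_uniq indep.
pose rest x := (\prod_(j <- rem i r) (1 + theta * s j x)) * F x.
have rest_inv x : rest (phi i x) = rest x.
  rewrite /rest F_inv (prod_reversal_indep (fun t => 1 + theta * t)) //.
    by move=> j; apply: mem_rem.
  by rewrite mem_rem_uniqF.
have tiltE x : tilt x * F x = (1 + theta * s i x) * rest x.
  by rewrite /tilt (big_rem i) //= mulrA.
have symm g := sum_symmetrize (reversalK indep ir) g
  (reversal_sign_opp indep ir) rest_inv.
transitivity (\sum_x (s i x * (1 + theta * s i x)) * rest x).
  by apply: eq_bigr => x _; rewrite mulrCA tiltE mulrA.
rewrite mulr_sumr (symm (fun t => t * (1 + theta * t))).
rewrite [RHS](_ : _ =
    \sum_x (theta * s i x ^+ 2 * (1 + theta * s i x)) * rest x).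
  rewrite (symm (fun t => theta * t ^+ 2 * (1 + theta * t))).
  by apply: eq_bigr => x _; field.
by apply: eq_bigr => x _; rewrite -mulrA -tiltE; ring.
Qed.

Hypothesis theta_ge0 : 0 <= theta.
Hypothesis theta_le1 : theta <= 1.

Lemma tilt_ge0 x : 0 <= tilt x.
Proof.
rewrite /tilt big_seq; apply: prodr_ge0 => i ir.
have := reversal_sign_le1 indep ir x; rewrite ler_norml => /andP[s_ge _].
have : 0 <= theta * (s i x + 1) by rewrite mulr_ge0 //; lra.
by move: theta_le1; lra.
Qed.

Lemma sum_tilt_sqr_le :
  \sum_x tilt x ^+ 2 <= (1 + theta ^+ 2) ^+ size r * #|X|%:R.
Proof.
have -> : \sum_x tilt x ^+ 2 =
    \sum_x (\prod_(i <- r) (1 + theta ^+ 2 * s i x ^+ 2)) * 1.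
  rewrite (eq_bigr (fun x => (\prod_(i <- r) (1 + theta * s i x) ^+ 2) * 1)).
    rewrite (sum_prod_symmetrize (fun t => (1 + theta * t) ^+ 2)) //.
      by apply: eq_bigr => x _; congr (_ * _); apply: eq_bigr => i _; field.
    exact: reversals_uniq indep.
  by move=> x _; rewrite mulr1 /tilt prodrXl.
rewrite mulr_natr -sumr_const; apply: ler_sum => x _.
have -> : (1 + theta ^+ 2) ^+ size r = \prod_(i <- r) (1 + theta ^+ 2).
  by rewrite big_const_seq count_predT iter_mulr_1.
rewrite mulr1 big_seq [leRHS]big_seq; apply: ler_prod => i ir.
have := reversal_sign_sqr_le1 x ir; have := sqr_ge0 (s i x).
have := sqr_ge0 theta.
by move=> ? ? ?; apply/andP; split; nra.
Qed.

Variable p : R.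
Hypothesis p_ge0 : 0 <= p.
Hypothesis p_le1 : p <= 1.
Hypothesis sign_sqr_uncorrelated : {in r &, forall i j, i != j ->
  \sum_x (s i x ^+ 2 - p) * (s j x ^+ 2 - p) = 0}.

Lemma sum_tilt_centered_sign i (F : X -> R) :
  i \in r -> (forall x, F (phi i x) = F x) ->
  \sum_x tilt x * ((s i x - theta * p) * F x) =
  theta * \sum_x tilt x * ((s i x ^+ 2 - p) * F x).
Proof.
move=> ir F_inv; under eq_bigr do rewrite mulrBl mulrBr.
rewrite sumrB sum_tilt_sign //.
under [in RHS]eq_bigr do rewrite mulrBl mulrBr.
rewrite sumrB mulrBr; congr (_ - _).
by rewrite mulr_sumr; apply: eq_bigr => x _; ring.
Qed.

Lemma sum_tilt_centered_signs_orthogonal i j :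
  i \in r -> j \in r -> i != j ->
  \sum_x tilt x * ((s i x - theta * p) * (s j x - theta * p)) = 0.
Proof.
move=> ir jr ij; rewrite sum_tilt_centered_sign // => [|x]; last first.
  by rewrite (reversal_indep indep) // eq_sym.
under eq_bigr do rewrite [_ * (s j _ - _)]mulrC.
rewrite sum_tilt_centered_sign // => [|x]; last by rewrite reversal_sign_sqr.
under eq_bigr do rewrite [_ * (s i _ ^+ 2 - _)]mulrC.
rewrite sum_tilt_invariant ?sign_sqr_uncorrelated ?mulr0 // => k kr x.
by rewrite !reversal_sign_sqr.
Qed.

Lemma sum_tilt_centered_sqr_le :
  \sum_x tilt x * (\sum_(i <- r) (s i x - theta * p)) ^+ 2 <=
  4 * (size r)%:R * #|X|%:R.
Proof.
rewrite sum_weighted_sqr_orthogonal ?(reversals_uniq indep) //; last first.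
  exact: sum_tilt_centered_signs_orthogonal.
have -> : 4 * (size r)%:R * #|X|%:R = \sum_(i <- r) (4 * #|X|%:R) :> R.
  by rewrite big_const_seq count_predT iter_addr_0 -mulr_natr; ring.
rewrite big_seq [leRHS]big_seq; apply: ler_sum => i ir.
rewrite -sum_tilt mulr_sumr; apply: ler_sum => x _.
rewrite mulrC ler_wpM2r ?tilt_ge0 //.
have := reversal_sign_le1 indep ir x; rewrite ler_norml => /andP[s_ge s_le].
have : 0 <= theta * p by rewrite mulr_ge0.
have : theta * p <= 1 by rewrite mulr_ile1.
by move=> ? ?; nra.
Qed.

Variables (h : X -> R) (v : R).
Hypothesis h_reversal : {in r, forall i x, h (phi i x) = h x - s i x}.
Hypothesis h_sqr : \sum_x h x ^+ 2 <= v * #|X|%:R.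

Definition invariant_part x : R := h x - (\sum_(i <- r) s i x) / 2.

Lemma invariant_part_reversal i x :
  i \in r -> invariant_part (phi i x) = invariant_part x.
Proof.
move=> ir; rewrite /invariant_part h_reversal // !(big_rem i ir) /=.
rewrite (reversal_sign_opp indep) // [\sum_(j <- _) s j (phi i x)](_ : _ =
  \sum_(j <- rem i r) s j x); first by field.
apply: eq_big_seq => j; rewrite (mem_rem_uniq _ (reversals_uniq indep)).
by move=> /andP[ji jr]; rewrite (reversal_indep indep).
Qed.

Lemma sum_invariant_part_sqr_le : \sum_x invariant_part x ^+ 2 <= v * #|X|%:R.
Proof.
apply: le_trans h_sqr.
have orth : \sum_x invariant_part x * \sum_(i <- r) s i x = 0.
  under eq_bigr do rewrite mulr_sumr.
  rewrite exchange_big /= big_seq big1 // => i ir.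
  apply: (sum_odd_involutive (reversalK indep ir)) => x.
  by rewrite (reversal_sign_opp indep) // invariant_part_reversal // mulrN.
rewrite -[leLHS]addr0 -[X in _ + X <= _]orth -big_split.
apply: ler_sum => x _ /=.
have := sqr_ge0 (\sum_(i <- r) s i x); rewrite /invariant_part.
by set S := \sum_(i <- r) _; lra.
Qed.

Definition drift : R := theta * p * (size r)%:R / 2.

Lemma sum_tilt_deviation_le :
  \sum_x tilt x * (h x - drift) ^+ 2 <= 2 * (v + (size r)%:R) * #|X|%:R.
Proof.
pose D x := \sum_(i <- r) (s i x - theta * p).
have hE x : h x - drift = invariant_part x + D x / 2.
  rewrite /D /drift /invariant_part sumrB big_const_seq count_predT iter_addr_0.
  by rewrite -mulr_natr; field.
apply: le_trans (_ : \sum_x (tilt x * (2 * invariant_part x ^+ 2) +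
    2^-1 * (tilt x * D x ^+ 2)) <= _).
  apply: ler_sum => x _; rewrite [X in _ <= _ + X]mulrCA -mulrDr.
  rewrite ler_wpM2l ?tilt_ge0 // hE.
  by have := sqr_ge0 (invariant_part x - D x / 2); lra.
rewrite big_split /= sum_tilt_invariant => [|i ir x]; last first.
  by rewrite invariant_part_reversal.
rewrite -!mulr_sumr.
by have := sum_tilt_centered_sqr_le; have := sum_invariant_part_sqr_le; lra.
Qed.

Hypothesis drift_gt0 : 0 < drift.
Hypothesis drift_large : 8 * (v + (size r)%:R) <= drift ^+ 2.

Lemma sum_tilt_nonpositive_le :
  \sum_x tilt x * (h x <= 0)%R%:R <= #|X|%:R / 4.
Proof.
have drift2_gt0 : 0 < drift ^+ 2 by rewrite exprn_gt0.
rewrite -(ler_pM2r drift2_gt0).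
apply: le_trans (_ : \sum_x tilt x * (h x - drift) ^+ 2 <= _).
  rewrite mulr_suml; apply: ler_sum => x _.
  rewrite -mulrA ler_wpM2l ?tilt_ge0 //.
  case: (leP (h x) 0) => hx /=; rewrite ?mul0r ?mul1r ?sqr_ge0 //.
  by have := mulr_ge0_le0 (ltW drift_gt0) hx; have := sqr_ge0 (h x); lra.
apply: le_trans sum_tilt_deviation_le _.
by have := ler_wpM2r (ler0n R #|X|) drift_large; lra.
Qed.

Lemma card_positive_ge (A : {set X}) :
  {in r, forall i x, (phi i x \in A) = (x \in A)} ->
  (#|X| <= 2 * #|A|)%N ->
  #|X|%:R <= 16 * (1 + theta ^+ 2) ^+ size r * #|[set x in A | 0 < h x]|%:R.
Proof.
move=> A_stable A_half; set B := [set x in A | _]; set C := _ ^+ size r.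
have tilted_A : #|X|%:R / 2 <= \sum_x tilt x * (x \in A)%:R.
  rewrite sum_tilt_invariant => [|i ir x]; last by rewrite A_stable.
  rewrite -natr_sum -big_mkcond sum1_card.
  by move: A_half; rewrite -(ler_nat R) natrM; lra.
have tilted_B : #|X|%:R / 4 <= \sum_(x in B) tilt x.
  have : \sum_x tilt x * (x \in A)%:R <=
      \sum_(x in B) tilt x + \sum_x tilt x * (h x <= 0)%R%:R.
    rewrite [\sum_(x in B) _]big_mkcond -big_split; apply: ler_sum => x _ /=.
    have := tilt_ge0 x; rewrite inE.
    by case: (x \in A); case: (leP (h x) 0) => _ /=; lra.
  by have := sum_tilt_nonpositive_le; lra.
have sqr_B : \sum_(x in B) tilt x ^+ 2 <= C * #|X|%:R.
  apply: le_trans sum_tilt_sqr_le; rewrite big_mkcond; apply: ler_sum => x _.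
  by case: ifP => _; rewrite ?sqr_ge0.
have [->|X_gt0] := posnP #|X|.
  by rewrite !mulr_ge0 // exprn_ge0 // addr_ge0 // sqr_ge0.
have XR_gt0 : 0 < #|X|%:R :> R by rewrite ltr0n.
rewrite -(ler_pM2l XR_gt0).
have := sqr_sum_le_card B tilt.
have : (#|X|%:R / 4) ^+ 2 <= (\sum_(x in B) tilt x) ^+ 2.
  by rewrite lerXn2r ?nnegrE ?divr_ge0 // (le_trans _ tilted_B) ?divr_ge0.
have := ler_wpM2l (ler0n R #|B|) sqr_B; lra.
Qed.

End ProductTilt.

(** * Bit strings and their residues *)

Local Notation bit x i := (nth false (tval x) i).

Definition bit_change (s : seq bool) i : bool :=
  nth false s i != nth false s i.+1.

Lemma bits_val_rcons s b : bits_val (rcons s b) = ((bits_val s).*2 + b)%N.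
Proof. by rewrite /bits_val -cats1 foldl_cat. Qed.

Lemma bits_val_sum s :
  bits_val s = (\sum_(k < size s) nth false s k * 2 ^ (size s - k.+1))%N.
Proof.
elim/last_ind: s => [|s b IH]; first by rewrite big_ord0.
rewrite bits_val_rcons IH size_rcons big_ord_recr /= nth_rcons ltnn eqxx.
rewrite subnn muln1 -mul2n big_distrr /=; congr (_ + _)%N.
apply: eq_bigr => k _; rewrite nth_rcons ltn_ord mulnCA -expnS.
by rewrite subSn.
Qed.

Lemma wt_sum s : wt s = (\sum_(k < size s) nth false s k)%N.
Proof. by rewrite /wt -sumn_count sumnE big_map (big_nth false) big_mkord. Qed.

Lemma bits_val_nseq_true n : (bits_val (nseq n true)).+1 = (2 ^ n)%N.
Proof.
elim: n => // n IH.
rewrite -[in LHS](addn1 n) nseqD cats1 bits_val_rcons expnS -IH -mul2n; lia.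
Qed.

Lemma bits_val_nseq_false n : bits_val (nseq n false) = 0%N.
Proof.
by elim: n => // n IH; rewrite -addn1 nseqD cats1 bits_val_rcons IH.
Qed.

Lemma ltn_bits_val n (x : n.-tuple bool) : (bits_val x < 2 ^ n)%N.
Proof.
rewrite -[in leqRHS](size_tuple x).
elim/last_ind: (tval x) => // s b IH; rewrite bits_val_rcons size_rcons expnS.
by case: b; lia.
Qed.

Lemma nth_bits_val s i : (i < size s)%N ->
  nth false s i = odd (bits_val s %/ 2 ^ (size s - i.+1)).
Proof.
elim/last_ind: s i => // s b IH i.
rewrite size_rcons ltnS leq_eqVlt nth_rcons bits_val_rcons => /predU1P[->|lt_i].
  by rewrite ltnn eqxx subnn divn1 oddD odd_double oddb.
rewrite lt_i IH // subSn // expnS divnMA -muln2 divnMDl //.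
by rewrite (divn_small (_ : b < 2)%N) ?addn0 //; case: b.
Qed.

Lemma bits_val_eq0_nth s i : bits_val s = 0%N -> nth false s i = false.
Proof.
move=> s0; have [lt_i|le_i] := ltnP i (size s); last by rewrite nth_default.
by rewrite nth_bits_val // s0 div0n.
Qed.

Lemma eq_from_bit n (x y : n.-tuple bool) :
  (forall i, (i < n)%N -> bit x i = bit y i) -> x = y.
Proof.
by move=> eq_xy; apply: eq_from_tnth => i; rewrite !(tnth_nth false) eq_xy.
Qed.

Lemma bits_val_inj n : injective (fun x : n.-tuple bool => bits_val x).
Proof.
move=> x y /= eq_val; apply: eq_from_bit => i lt_i.
by rewrite !nth_bits_val ?size_tuple // eq_val.
Qed.

Fixpoint bits_of n v : n.-tuple bool :=
  if n is k.+1 then rcons_tuple (bits_of k v./2) (odd v) else [tuple].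

Lemma bits_ofK n v : (v < 2 ^ n)%N -> bits_val (bits_of n v) = v.
Proof.
elim: n v => [|n IH] v lt_v; first by case: v lt_v.
have lt_half : (v./2 < 2 ^ n)%N by move: lt_v; rewrite expnS; lia.
by rewrite /= bits_val_rcons IH // addnC odd_double_half.
Qed.

Lemma modn_inj_pos d a b :
  (0 < a <= d)%N -> (0 < b <= d)%N -> a = b %[mod d] -> a = b.
Proof.
case: a b => [|a] [|b] //= lt_a lt_b /eqP.
by rewrite -addn1 -[b.+1]addn1 eqn_modDr !modn_small // => /eqP ->.
Qed.

Section Residues.
Variable n : nat.
Implicit Types x y : n.-tuple bool.

Definition place_value i : Zmers n := inZp 1 *+ 2 ^ (n - i.+1).

Lemma residue_mulrn x : residue x = inZp 1 *+ bits_val x.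
Proof. by rewrite Zp_mulrn; apply: val_inj; rewrite /= modnMml mul1n. Qed.

Lemma residue_sum_place_value x :
  residue x = \sum_(k < n) place_value k *+ bit x k.
Proof.
rewrite residue_mulrn bits_val_sum size_tuple -sumrMnr; apply: eq_bigr => k _.
by rewrite mulnC mulrnA.
Qed.

Lemma place_value_pred i :
  (0 < i < n)%N -> place_value i.-1 = place_value i *+ 2.
Proof.
move=> i_range; rewrite /place_value -mulrnA -expnSr; congr (_ *+ 2 ^ _).
by lia.
Qed.

Hypothesis n_gt0 : (0 < n)%N.

Let mersenne_succ : (2 ^ n = (2 ^ n - 2).+2)%N.
Proof. by have := leq_pexp2l (isT : 0 < 2)%N n_gt0; lia. Qed.

Lemma mulrn_pow2 (a : Zmers n) : a *+ 2 ^ n = a.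
Proof.
rewrite Zp_mulrn; apply: val_inj; case: a => v lt_v /=.
have -> : (v * 2 ^ n = v * (2 ^ n - 2).+1 + v)%N.
  by rewrite {1}mersenne_succ mulnS addnC.
by rewrite modnMDl modn_small.
Qed.

Lemma residue_nseq_true : residue (nseq_tuple n true) = 0.
Proof.
apply: val_inj => /=.
have -> : bits_val (nseq n true) = (2 ^ n - 2).+1.
  by have := bits_val_nseq_true n; lia.
by rewrite modnn.
Qed.

Lemma residue_inj_neq0 :
  {in [pred x : n.-tuple bool | bits_val x != 0%N] &, injective (@residue n)}.
Proof.
move=> x y; rewrite !inE -!lt0n => x_gt0 y_gt0 /(congr1 val) /= eq_mod.
have le_val (z : n.-tuple bool) : (bits_val z <= (2 ^ n - 2).+1)%N.
  by have := ltn_bits_val z; lia.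
by apply/bits_val_inj/(modn_inj_pos _ _ eq_mod); rewrite ?x_gt0 ?y_gt0 /=.
Qed.

Lemma residue_surj (a : Zmers n) : exists x, residue x = a.
Proof.
exists (bits_of n a); apply: val_inj; case: a => v lt_v /=.
by rewrite bits_ofK ?modn_small //; lia.
Qed.

(* The only two strings with the same residue, 0^n and 1^n, differ in every
   position. *)
Lemma residue_inj_bit i x y : (i < n)%N ->
  residue x = residue y -> bit x i = bit y i -> x = y.
Proof.
move=> lt_i; wlog y_neq0 : x y / bits_val y != 0%N => [base|].
  have [y0|y_neq0] := eqVneq (bits_val y) 0%N; last exact: base.
  have [x0|x_neq0] := eqVneq (bits_val x) 0%N.
    by move=> _ _; apply: bits_val_inj; rewrite x0 y0.
  by move=> rxy bxy; apply/esym/base.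
have [x0|x_neq0] := eqVneq (bits_val x) 0%N; last first.
  by move=> rxy _; apply: residue_inj_neq0.
have -> : residue x = residue (nseq_tuple n true).
  by rewrite residue_nseq_true residue_mulrn x0 mulr0n.
have ones_neq0 : bits_val (nseq n true) != 0%N.
  by have := bits_val_nseq_true n; lia.
rewrite bits_val_eq0_nth // => /residue_inj_neq0 <- //.
by rewrite nth_nseq lt_i.
Qed.

End Residues.

Section Flip.
Variables (n i : nat).
Hypothesis lt_i : (i < n)%N.
Implicit Type x : n.-tuple bool.

Definition flip x : n.-tuple bool := [tuple (val k == i) (+) tnth x k | k < n].

Lemma nth_flip x j : bit (flip x) j = (j == i) (+) bit x j.
Proof.
have [lt_j|le_j] := ltnP j n.
  have := tnth_mktuple (fun k : 'I_n => (val k == i) (+) tnth x k)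
    (Ordinal lt_j).
  by rewrite !(tnth_nth false).
rewrite !nth_default ?size_tuple //; case: eqP => // ji.
by move: lt_i; rewrite -ji ltnNge le_j.
Qed.

Lemma flipK : involutive flip.
Proof. by move=> x; apply: eq_from_bit => j _; rewrite !nth_flip addKb. Qed.

Lemma sum_bits_flip (V : zmodType) (w : nat -> V) x :
  \sum_(k < n) w k *+ bit (flip x) k =
  \sum_(k < n) w k *+ bit x k + w i *~ (-1) ^+ bit x i.
Proof.
rewrite (bigD1 (Ordinal lt_i)) // [in RHS](bigD1 (Ordinal lt_i)) //=.
rewrite [in RHS]addrAC nth_flip eqxx addTb; congr (_ + _).
  by case: (bit x i); rewrite /= ?mulrN1z ?subrr ?add0r ?mulr1z.
apply: eq_bigr => k ki; rewrite nth_flip -(inj_eq val_inj) /= in ki *.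
by rewrite (negPf ki).
Qed.

Lemma residue_flip x :
  residue (flip x) = residue x + place_value n i *~ (-1) ^+ bit x i.
Proof. by rewrite !residue_sum_place_value sum_bits_flip. Qed.

Lemma wt_flip (R : pzRingType) x :
  (wt (flip x))%:R = (wt x)%:R + (-1) ^+ bit x i :> R.
Proof.
by rewrite !wt_sum !size_tuple !natr_sum (sum_bits_flip (fun=> 1)) intr_sign.
Qed.

End Flip.

(** * Addition with end-around carry *)

(* When the summands agree in position e, the lower bits do not influence the
   carry out of it. *)
Lemma divn_pow2_add_carry e a b (d : bool) :
  odd (a %/ 2 ^ e) = odd (b %/ 2 ^ e) ->
  ((a + b + d) %/ 2 ^ e.+1 =
   a %/ 2 ^ e.+1 + b %/ 2 ^ e.+1 + odd (b %/ 2 ^ e))%N.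
Proof.
have low_sum_lt ta tb m : (ta < m -> tb < m -> ta + tb + d < 2 * m)%N.
  by case: d; lia.
move=> odd_ab; have half k : (k %/ 2 ^ e.+1 = (k %/ 2 ^ e)./2)%N.
  by rewrite expnSr divnMA divn2.
have split_low k : k = (k %/ 2 ^ e.+1 * 2 ^ e.+1 +
    (odd (k %/ 2 ^ e) * 2 ^ e + k %% 2 ^ e))%N.
  rewrite {1}(divn_eq k (2 ^ e)) -{1}(odd_double_half (k %/ 2 ^ e)) -half.
  by rewrite mulnDl -muln2 -mulnA -expnS addnA [(_ * 2 ^ e.+1 + _)%N]addnC.
have low_lt k : (k %% 2 ^ e < 2 ^ e)%N by rewrite ltn_pmod ?expn_gt0.
rewrite {1}(split_low a) {1}(split_low b) odd_ab.
set qa := (a %/ _)%N; set qb := (b %/ 2 ^ e.+1)%N; set s := odd _.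
have := low_lt b; have := low_lt a.
move: (a %% _)%N (b %% _)%N => ta tb lt_ta lt_tb.
have -> : (qa * 2 ^ e.+1 + (s * 2 ^ e + ta) + (qb * 2 ^ e.+1 +
    (s * 2 ^ e + tb)) + d = (qa + qb + s) * 2 ^ e.+1 + (ta + tb + d))%N.
  by rewrite expnS; ring.
rewrite divnMDl ?expn_gt0 // divn_small ?addn0 // expnS.
exact: low_sum_lt.
Qed.

Section EndAroundAdd.
Variables (n : nat) (sigma : n.-tuple bool).
Implicit Types x y : n.-tuple bool.

Definition wraps x : bool := (2 ^ n <= bits_val x + bits_val sigma)%N.

(* Both 0^n and 1^n represent the residue 0: fixing 0^n is what makes the map
   injective. *)
Definition end_around_add x : n.-tuple bool :=
  if bits_val x == 0%N then x else
  bits_of n (bits_val x + bits_val sigma + wraps x - wraps x * 2 ^ n).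

Lemma bits_val_end_around_add x : bits_val x != 0%N ->
  (bits_val (end_around_add x) + wraps x * 2 ^ n =
   bits_val x + bits_val sigma + wraps x)%N.
Proof.
move=> x_neq0; rewrite /end_around_add (negPf x_neq0).
have := ltn_bits_val x; have := ltn_bits_val sigma; rewrite /wraps.
by case: leqP => ? ? ?; rewrite /= bits_ofK; lia.
Qed.

Lemma end_around_add_eq0 x :
  (bits_val (end_around_add x) == 0%N) = (bits_val x == 0%N).
Proof.
have [x0|x_neq0] := eqVneq (bits_val x) 0%N.
  by rewrite /end_around_add x0 eqxx; apply/eqP.
have := bits_val_end_around_add x_neq0; rewrite /wraps.
by case: leqP => ? /= ?; apply/negbTE; lia.
Qed.

Hypothesis n_gt0 : (0 < n)%N.

Lemma residue_end_around_add x : bits_val x != 0%N ->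
  residue (end_around_add x) = residue sigma + residue x.
Proof.
move=> /bits_val_end_around_add /(congr1 (fun k => (inZp 1 : Zmers n) *+ k)).
rewrite !mulrnDr mulnC mulrnA mulrn_pow2 // => /addIr.
by rewrite !residue_mulrn [RHS]addrC.
Qed.

Lemma end_around_add_inj : injective end_around_add.
Proof.
move=> x y eq_xy; have := end_around_add_eq0 x.
rewrite eq_xy end_around_add_eq0.
have [x0|x_neq0] := eqVneq (bits_val x) 0%N => [/eqP y0|/negbT y_neq0].
  by apply: bits_val_inj; rewrite x0 y0.
apply: (residue_inj_neq0 n_gt0) => //; apply: (addrI (residue sigma)).
by rewrite -!residue_end_around_add // eq_xy.
Qed.

End EndAroundAdd.

Section BitSwaps.
Variables (n : nat) (sigma : n.-tuple bool).
Implicit Types (x : n.-tuple bool) (i j : nat).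

Definition inner_change i := [&& 0 < i, i.+1 < n & bit_change sigma i]%N.

Definition active i x :=
  (bit x i.+1 == bit sigma i.+1) && (bit x i.-1 != bit x i).

Definition swap i x := if active i x then flip i (flip i.-1 x) else x.

Definition swap_sign (R : pzRingType) i x : R :=
  if active i x then (-1) ^+ bit x i else 0.

Definition apart i j := (i + 2 < j)%N || (j + 2 < i)%N.

Lemma swap_sign_sqr (R : pzRingType) i x :
  swap_sign R i x ^+ 2 = (active i x)%:R.
Proof.
by rewrite /swap_sign; case: (active i x); rewrite ?sqrr_sign ?expr0n.
Qed.

Section ChangePosition.
Variable i : nat.
Hypothesis change_i : inner_change i.

Let i_gt0 : (0 < i)%N. Proof. by case/and3P: change_i. Qed.
Let lt_i : (i < n)%N. Proof. by case/and3P: change_i => _ /ltnW. Qed.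
Let lt_pred_i : (i.-1 < n)%N.
Proof. exact: leq_ltn_trans (leq_pred i) lt_i. Qed.
Let n_gt0 : (0 < n)%N. Proof. exact: leq_ltn_trans lt_i. Qed.
Let i_neq_pred : (i == i.-1) = false. Proof. by lia. Qed.

Lemma nth_swap x j :
  bit (swap i x) j = (active i x && ((j == i) || (j == i.-1))) (+) bit x j.
Proof.
rewrite /swap; case: (active i x) => //=; rewrite !nth_flip //.
by have [->|ji] := eqVneq j i; rewrite ?i_neq_pred ?addFb.
Qed.

Lemma active_swap x : active i (swap i x) = active i x.
Proof.
rewrite /active !nth_swap !eqxx orbT /= !andbT.
have -> : (i.+1 == i) || (i.+1 == i.-1) = false by lia.
by rewrite andbF addFb; case: (active i x); rewrite //= (inj_eq negb_inj).
Qed.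

Lemma swapK : involutive (swap i).
Proof.
by move=> x; apply: eq_from_bit => j _; rewrite !nth_swap active_swap addKb.
Qed.

Lemma swap_sign_swap (R : pzRingType) x :
  swap_sign R i (swap i x) = - swap_sign R i x.
Proof.
rewrite /swap_sign active_swap nth_swap eqxx /=.
by case: (active i x); rewrite ?oppr0 //= signrN.
Qed.

Lemma nth_swap_apart j k x : apart i j -> (j.-1 <= k <= j.+1)%N ->
  bit (swap i x) k = bit x k.
Proof.
move=> far jk; rewrite nth_swap.
have -> : (k == i) || (k == i.-1) = false by move: far jk; rewrite /apart; lia.
by rewrite andbF.
Qed.

Lemma swap_sign_apart (R : pzRingType) j x :
  apart i j -> swap_sign R j (swap i x) = swap_sign R j x.
Proof.
by move=> far; rewrite /swap_sign /active !(nth_swap_apart _ far) //; lia.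
Qed.

Lemma wt_swap x : wt (swap i x) = wt x.
Proof.
rewrite /swap; case: ifP => // /andP[_ neq_bits].
apply/eqP; rewrite -(eqr_nat int) !wt_flip // nth_flip // i_neq_pred /=.
move: neq_bits; case: (bit x i); case: (bit x i.-1) => //= _.
  by rewrite addrK.
by rewrite addrNK.
Qed.

Lemma residue_swap x : active i x ->
  residue (swap i x) = residue x - place_value n i *~ (-1) ^+ bit x i.
Proof.
move=> x_active; rewrite /swap x_active !residue_flip //.
rewrite nth_flip // i_neq_pred addFb.
have -> : bit x i.-1 = ~~ bit x i.
  by case/andP: x_active => _; case: (bit x i); case: (bit x i.-1).
rewrite place_value_pred ?i_gt0 // signrN mulrNz mulr2n mulrzDl.
by rewrite opprD addrA subrK.
Qed.

Lemma active_neq0 x : active i x -> bits_val x != 0%N.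
Proof.
by case/andP=> _; apply: contraNneq => x0; rewrite !bits_val_eq0_nth.
Qed.

Local Notation T := (end_around_add sigma).

(* The carry into position i is sigma_(i+1), which differs from sigma_i. *)
Lemma nth_end_around_add x : active i x -> bit (T x) i = ~~ bit x i.
Proof.
move=> x_active; have x_neq0 := active_neq0 x_active.
case/andP: x_active => /eqP + _.
have /and3P[_ lt_i1] := change_i.
rewrite /bit_change !nth_bits_val ?size_tuple //.
have -> : (n - i.+1 = (n - i.+2).+1)%N by lia.
move=> neq_sigma /divn_pow2_add_carry carryE.
have := carryE (wraps sigma x); rewrite -bits_val_end_around_add //.
have -> : (2 ^ n = 2 ^ i.+1 * 2 ^ (n - i.+2).+1)%N.
  by rewrite -expnD addnS -addSn subnKC.
rewrite mulnA addnC divnMDl ?expn_gt0 // => /(congr1 odd).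
rewrite !oddD oddM oddX /= andbF /= oddb => ->.
by move: neq_sigma; case: odd; case: odd; case: odd.
Qed.

(* Both sides have the same residue and the same bit in position i. *)
Lemma end_around_add_swap x : active i x -> T (swap i x) = flip i (T x).
Proof.
move=> x_active; have swap_active : active i (swap i x) by rewrite active_swap.
apply: (residue_inj_bit n_gt0 lt_i); last first.
  by rewrite nth_flip // !nth_end_around_add // nth_swap x_active eqxx.
rewrite residue_flip // !residue_end_around_add ?active_neq0 //.
by rewrite nth_end_around_add // residue_swap // signrN mulrNz addrA.
Qed.

Lemma wt_end_around_add_swap (R : pzRingType) x :
  (wt (T (swap i x)))%:R = (wt (T x))%:R - swap_sign R i x :> R.
Proof.
rewrite /swap_sign; case: ifP => [x_active|x_inactive].
  by rewrite end_around_add_swap // wt_flip // nth_end_around_add // signrN.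
by rewrite /swap x_inactive subr0.
Qed.

Lemma sum_active_quarter (R : realFieldType) (F : n.-tuple bool -> R) :
  (forall x, F (flip i.+1 x) = F x) -> (forall x, F (flip i.-1 x) = F x) ->
  \sum_x (active i x)%:R * F x = 4^-1 * \sum_x F x.
Proof.
move=> F_succ F_pred; have lt_i1 : (i.+1 < n)%N by case/and3P: change_i.
pose agree x := bit x i.+1 == bit sigma i.+1.
pose differ x := bit x i.-1 != bit x i.
transitivity (\sum_x (agree x)%:R * ((differ x)%:R * F x)).
  by apply: eq_bigr => x _; rewrite mulrA -natrM mulnb.
rewrite (sum_indicator_half (flipK lt_i1)) => [|x|x].
- rewrite (sum_indicator_half (flipK lt_pred_i)) // => [|x]; first by field.
  rewrite /differ !nth_flip // eqxx i_neq_pred.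
  by case: (bit x i); case: (bit x i.-1).
- rewrite /agree nth_flip // eqxx.
  by case: (bit x i.+1); case: (bit sigma i.+1).
- rewrite /differ !nth_flip // F_succ; congr (_%:R * _).
  have -> : (i.-1 == i.+1) = false by lia.
  by have -> : (i == i.+1) = false by lia.
Qed.

Lemma active_flip_apart j k x : apart i j -> (i.-1 <= k <= i.+1)%N ->
  (k < n)%N -> active j (flip k x) = active j x.
Proof.
rewrite /apart => far ik lt_k; rewrite /active !nth_flip //.
have -> : (j == k) = false by lia.
have -> : (j.-1 == k) = false by lia.
by have -> : (j.+1 == k) = false by lia.
Qed.

Lemma swap_sign_sqr_uncorrelated (R : realFieldType) j : apart i j ->
  \sum_x (swap_sign R i x ^+ 2 - 4^-1) * (swap_sign R j x ^+ 2 - 4^-1) = 0.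
Proof.
move=> far; have lt_i1 : (i.+1 < n)%N by case/and3P: change_i.
under eq_bigr do rewrite !swap_sign_sqr mulrBl.
rewrite sumrB sum_active_quarter => [|x|x].
- by rewrite -mulr_sumr subrr.
- by rewrite active_flip_apart //; lia.
- by rewrite active_flip_apart //; lia.
Qed.

End ChangePosition.

Lemma swap_reversals (R : realFieldType) (q : seq nat) :
  uniq q -> {in q, forall i, inner_change i} ->
  {in q &, forall i j, i != j -> apart i j} ->
  independent_reversals q swap (swap_sign R).
Proof.
move=> q_uniq q_change q_apart; split=> // [i iq|i iq x|i j iq jq x ji|i iq x].
- exact/swapK/q_change.
- exact/swap_sign_swap/q_change.
- by rewrite swap_sign_apart ?q_change ?q_apart // eq_sym.
- by rewrite /swap_sign; case: ifP => _; rewrite ?normr_sign ?normr0.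
Qed.

End BitSwaps.

(** * Light strings, runs and the union of shifts *)

Lemma card_bitstrings n : #|{: n.-tuple bool}| = (2 ^ n)%N.
Proof. by rewrite card_tuple card_bool. Qed.

Lemma pow2_le_card_light n : (2 ^ n <= 2 * #|light n|)%N.
Proof.
pose neg (x : n.-tuple bool) := map_tuple negb x.
have neg_inj : injective neg.
  by move=> x y /(congr1 val) /= /(inj_map negb_inj) /val_inj.
suff heavy_le : (#|~: light n| <= #|light n|)%N.
  by rewrite -card_bitstrings -(cardsC (light n)); lia.
rewrite -(card_imset _ neg_inj).
apply/subset_leq_card/subsetP => _ /imsetP[x + ->].
rewrite !inE -ltnNge /wt /= count_map => x_heavy.
have := count_predC id x; rewrite size_tuple.
have -> : count (preim negb id) x = count (predC id) x by apply: eq_count.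
by move: x_heavy; move: (count id x) (count (predC id) x) => ones zeros; lia.
Qed.

Lemma sum_wt_deviation_sqr (R : realFieldType) n :
  \sum_(x : n.-tuple bool) ((wt x)%:R - n%:R / 2) ^+ 2 =
  n%:R / 4 * #|{: n.-tuple bool}|%:R :> R.
Proof.
pose f (k : 'I_n) (x : n.-tuple bool) : R := (bit x k)%:R - 2^-1.
transitivity (\sum_(x : n.-tuple bool) 1 * (\sum_(k <- enum 'I_n) f k x) ^+ 2).
  apply: eq_bigr => x _; rewrite mul1r; congr (_ ^+ 2).
  rewrite big_enum /= sumrB sumr_const card_ord -natr_sum wt_sum size_tuple.
  by rewrite -[2^-1 *+ n]mulr_natl.
rewrite sum_weighted_sqr_orthogonal ?enum_uniq //.
  have f_sqr k x : 1 * f k x ^+ 2 = 4^-1.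
    by rewrite /f; case: (bit x k) => /=; field.
  under eq_bigr do under eq_bigr do rewrite f_sqr.
  rewrite big_enum /= !sumr_const card_ord -[_ *+ _ *+ _]mulr_natr.
  by rewrite -[4^-1 *+ _]mulr_natr; ring.
move=> k l _ _ kl; apply: (sum_odd_involutive (flipK (ltn_ord k))) => x.
rewrite /f !nth_flip ?ltn_ord // eqxx (inj_eq val_inj) eq_sym (negPf kl) addFb.
by case: (bit x k) => /=; field.
Qed.

Definition num_changes (s : seq bool) : nat :=
  count (bit_change s) (iota 0 (size s).-1).

Lemma num_changes_cons b a s :
  num_changes [:: b, a & s] = ((b != a) + num_changes (a :: s))%N.
Proof. by rewrite /num_changes /= -[1%N]addn0 iotaDl count_map. Qed.

Lemma num_changes_nseq m b a s : (0 < m)%N ->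
  ((b != a) + num_changes (a :: s) <= num_changes (nseq m b ++ a :: s))%N.
Proof.
case: m => // m _; elim: m => [|m IH]; first by rewrite num_changes_cons.
by apply: leq_trans IH _; rewrite /= num_changes_cons leq_addl.
Qed.

Lemma size_maximal_runs s r :
  maximal_runs s r -> (size r <= (num_changes s).+1)%N.
Proof.
case=> ->; elim: r {s} => // -[b m] [|[a k] r] // IH.
move=> /= /and3P[m_gt0 k_gt0 r_gt0] /andP[ba r_sorted].
have {IH} := IH _ r_sorted; rewrite /= k_gt0 r_gt0 => /(_ isT) IH.
case: k k_gt0 r_sorted IH => // k _ _ IH; rewrite ltnS; apply: leq_trans IH _.
have := num_changes_nseq b a
  (nseq k a ++ flatten [seq nseq p.2 p.1 | p <- r]) m_gt0.
by rewrite /= ba add1n.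
Qed.

Lemma exists_frequent_residue (T : Type) (p : pred T) (f : T -> nat) d s :
  (0 < d)%N ->
  exists a, (count p s <= d * count (fun x => p x && (f x %% d == a)%N) s)%N.
Proof.
case: d => // d _.
pose class_count (a : 'I_d.+1) := count (fun x => p x && (inZp (f x) == a)) s.
have -> : count p s = (\sum_a class_count a)%N.
  rewrite -sum1_count (partition_big (fun x => inZp (f x) : 'I_d.+1) xpredT) //.
  by apply: eq_bigr => a _; rewrite sum1_count.
case: (@arg_maxnP _ ord0 xpredT class_count) => // a _ a_max; exists (val a).
apply: leq_trans (_ : \sum_(b < d.+1) class_count a <= _)%N.
  by apply: leq_sum => b _; apply: a_max.
by rewrite sum_nat_const card_ord.
Qed.

Section ChangePositions.
Variables (n : nat) (sigma : n.-tuple bool).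

Definition change_positions a : seq nat :=
  [seq i <- iota 1 n.-2 | bit_change sigma i && (i %% 3 == a)%N].

Lemma change_positions_change a :
  {in change_positions a, forall i, inner_change sigma i}.
Proof.
move=> i; rewrite mem_filter mem_iota /inner_change.
by move=> /andP[/andP[-> _] /andP[i_gt0 lt_i]]; rewrite andbT i_gt0 /=; lia.
Qed.

Lemma change_positions_apart a :
  {in change_positions a &, forall i j, i != j -> apart i j}.
Proof.
move=> i j; rewrite !mem_filter => /andP[/andP[_ /eqP ia] _].
by move=> /andP[/andP[_ /eqP ja] _]; rewrite /apart; lia.
Qed.

Lemma exists_many_change_positions (R : realFieldType) (c : R) r :
  maximal_runs sigma r -> c * n%:R <= (size r)%:R -> 4 <= c * n%:R ->
  exists a, c / 6 * n%:R <= (size (change_positions a))%:R.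
Proof.
move=> /size_maximal_runs le_r r_ge cn_ge.
set inner := iota 1 n.-2.
have le_inner : (num_changes sigma <= (count (bit_change sigma) inner).+1)%N.
  rewrite /num_changes size_tuple /inner; move: (bit_change sigma).
  case: n => [|[|k]] // differs.
  by rewrite /= -[leqRHS]add1n leq_add2r leq_b1.
have [a le_a] :=
  exists_frequent_residue (bit_change sigma) id inner (isT : 0 < 3)%N.
have {}le_a : (count (bit_change sigma) inner <=
    3 * size (change_positions a))%N by rewrite size_filter.
have : (size r)%:R <= (3 * size (change_positions a) + 2)%:R :> R.
  by rewrite ler_nat; lia.
by rewrite natrD natrM => size_r_le; exists a; lra.
Qed.

End ChangePositions.

Section Crossing.
Variables (n : nat) (sigma : n.-tuple bool).
Hypothesis n_gt0 : (0 < n)%N.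

Local Notation T := (end_around_add sigma).

Definition crossing : {set n.-tuple bool} := light n :\: T @^-1: light n.

Lemma card_light_crossing_le :
  (#|light n| + #|crossing| <=
   #|light n :|: shift (residue sigma) (light n)|)%N.
Proof.
have sub : T @: crossing \subset shift (residue sigma) (light n) :\: light n.
  apply/subsetP => _ /imsetP[x + ->]; rewrite in_setD inE.
  move=> /andP[Tx_heavy x_light]; rewrite in_setD Tx_heavy inE.
  have x_neq0 : bits_val x != 0%N.
    by apply: contraNneq Tx_heavy => x0; rewrite /end_around_add x0 eqxx.
  by rewrite residue_end_around_add //; apply/imsetP; exists x.
rewrite -[#|crossing|](card_imset _ (@end_around_add_inj n sigma n_gt0)).
apply: leq_trans (leq_add (leqnn _) (subset_leq_card sub)) _.
by rewrite cardsU cardsD setIC addnBA ?subset_leq_card ?subsetIr.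
Qed.

Section TiltedSwaps.
Variables (R : realFieldType) (q : seq nat).
Hypothesis q_uniq : uniq q.
Hypothesis q_change : {in q, forall i, inner_change sigma i}.
Hypothesis q_apart : {in q &, forall i j, i != j -> apart i j}.

Lemma size_changes_le : (size q <= n)%N.
Proof.
rewrite -(size_iota 0 n); apply: uniq_leq_size => // i /q_change.
by rewrite mem_iota => /and3P[_ /ltnW].
Qed.

(* 640 = 64 * 10: the drift is theta |q| / 8 and its square has to dominate
   8 (n / 4 + |q|) <= 10 n. *)
Lemma pow2_le_card_crossing (theta : R) : 0 < theta -> theta <= 1 ->
  640 * n%:R <= (theta * (size q)%:R) ^+ 2 ->
  2 ^+ n <= 16 * (1 + theta ^+ 2) ^+ size q * #|crossing|%:R.
Proof.
move=> theta_gt0 theta_le1 q_large.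
have nR_gt0 : 0 < n%:R :> R by rewrite ltr0n.
have q_le : (size q)%:R <= n%:R :> R by rewrite ler_nat size_changes_le.
have q_gt0 : 0 < (size q)%:R :> R.
  rewrite lt0r ler0n andbT; apply: contraTneq q_large => ->.
  by rewrite mulr0 expr0n /=; lra.
have rev := swap_reversals R q_uniq q_change q_apart.
pose h x : R := (wt (T x))%:R - n%:R / 2.
have -> : crossing = [set x in light n | 0 < h x].
  apply/setP => x; rewrite !inE andbC; congr (_ && _).
  by rewrite -ltnNge -(ltr_nat R) -muln2 natrM /h; apply/idP/idP; lra.
have -> : 2 ^+ n = #|{: n.-tuple bool}|%:R :> R.
  by rewrite card_bitstrings natrX.
apply: (card_positive_ge rev (ltW theta_gt0) theta_le1 (p := 4^-1) _ _ _
  (v := n%:R / 4)).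
- by lra.
- by lra.
- by move=> i j iq jq ij; rewrite swap_sign_sqr_uncorrelated ?q_change ?q_apart.
- by move=> i iq x; rewrite /h wt_end_around_add_swap ?q_change // addrAC.
- rewrite -sum_wt_deviation_sqr.
  by rewrite [leRHS](reindex_inj (@end_around_add_inj n sigma n_gt0)).
- by rewrite /drift !mulr_gt0 ?invr_gt0.
- by move: q_large; rewrite /drift; lra.
- by move=> i iq x; rewrite !inE wt_swap ?q_change.
- by rewrite card_bitstrings pow2_le_card_light.
Qed.

End TiltedSwaps.

Lemma pow2_le_expR_card_crossing (R : realType) (A c : R) a :
  0 < c -> 26 <= A * c -> A ^+ 2 <= n%:R ->
  c * n%:R <= (size (change_positions sigma a))%:R ->
  2 ^+ n <= 16 * expR (A ^+ 2) * #|crossing|%:R :> R.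
Proof.
move=> c_gt0 Ac_ge An; set q := change_positions sigma a => q_ge.
have nR_gt0 : 0 < n%:R :> R by rewrite ltr0n.
have A_gt0 : 0 < A by rewrite -(pmulr_lgt0 _ c_gt0) (lt_le_trans _ Ac_ge).
have q_uniq : uniq q by rewrite filter_uniq ?iota_uniq.
have q_change := @change_positions_change n sigma a.
have q_le : (size q)%:R <= n%:R :> R.
  by rewrite ler_nat (size_changes_le q_uniq q_change).
have A_sqr_div_le1 : A ^+ 2 / n%:R <= 1 by rewrite ler_pdivrMr ?mul1r.
have [theta theta_gt0 theta_sqr] :
    exists2 theta, 0 < theta & theta ^+ 2 = A ^+ 2 / n%:R.
  exists (A / Num.sqrt n%:R); first by rewrite divr_gt0 ?sqrtr_gt0.
  by rewrite expr_div_n sqr_sqrtr ?ltW.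
have theta_le1 : theta <= 1.
  by rewrite -(expr_le1 (isT : 0 < 2)%N (ltW theta_gt0)) theta_sqr.
have drift_large : 640 * n%:R <= (theta * (size q)%:R) ^+ 2.
  apply: le_trans (_ : (theta * (c * n%:R)) ^+ 2 <= _); last first.
    have [theta_ge0 c_ge0] := (ltW theta_gt0, ltW c_gt0).
    by apply: lerXn2r; rewrite ?nnegrE ?ler_wpM2l ?mulr_ge0.
  have -> : (theta * (c * n%:R)) ^+ 2 = (A * c) ^+ 2 * n%:R.
    by rewrite exprMn theta_sqr; field; rewrite gt_eqF.
  by rewrite ler_wpM2r //; nra.
apply: le_trans (pow2_le_card_crossing q_uniq q_change
  (@change_positions_apart n sigma a) theta_gt0 theta_le1 drift_large) _.
rewrite ler_wpM2r // ler_wpM2l //.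
apply: le_trans (_ : expR (theta ^+ 2) ^+ size q <= _).
  by rewrite lerXn2r ?nnegrE ?expR_ge0 ?expR_ge1Dx // addr_ge0 ?sqr_ge0.
rewrite -expRM_natr ler_expR theta_sqr -mulrA ler_piMr ?sqr_ge0 //.
by rewrite mulrC ler_pdivrMr ?mul1r.
Qed.

End Crossing.

Lemma ltn_card_light_shift n (alpha : Zmers n) : (0 < n)%N ->
  (#|light n| < #|light n :|: shift alpha (light n)|)%N.
Proof.
move=> n_gt0; apply/proper_card; rewrite properEneq subsetUl andbT.
apply/eqP => /esym/setUidPl shift_sub; pose L := @residue n @: light n.
have shiftE : [set alpha + residue x | x in light n] = L.
  have -> : [set alpha + residue x | x in light n] = +%R alpha @: L.
    by rewrite -imset_comp.
  apply/eqP; rewrite eqEcard (card_imset _ (addrI alpha)) leqnn andbT.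
  apply/subsetP => _ /imsetP[_ /imsetP[x x_light ->] ->].
  have [y yE] := residue_surj n_gt0 (alpha + residue x).
  rewrite -yE imset_f //; apply: (subsetP shift_sub).
  by rewrite inE yE; apply/imsetP; exists x.
suff : nseq_tuple n true \in light n.
  by rewrite inE /= /wt count_nseq; lia.
apply: (subsetP shift_sub); rewrite inE shiftE residue_nseq_true //.
apply/imsetP; exists (nseq_tuple n false); first by rewrite inE /wt count_nseq.
by rewrite residue_mulrn bits_val_nseq_false.
Qed.

Section ShiftingProperty.
Variables (R : realType) (n : nat).
Hypothesis n_gt0 : (0 < n)%N.

Lemma shifting_property_of_card (eps : R) (alpha : Zmers n) k :
  (#|light n| + k <= #|light n :|: shift alpha (light n)|)%N ->
  eps * 2 ^+ n <= k%:R -> shifting_property eps alpha.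
Proof.
rewrite -(ler_nat R) natrD => card_ge eps_le; apply: le_trans card_ge.
rewrite mulrDl lerD // mulrC ler_pdivrMr // mulrC -natrX -natrM ler_nat.
exact: pow2_le_card_light.
Qed.

Lemma le_shifting_property (eps eps' : R) (alpha : Zmers n) :
  eps <= eps' -> shifting_property eps' alpha -> shifting_property eps alpha.
Proof.
by move=> le_eps; apply: le_trans; rewrite ler_wpM2r ?exprn_ge0 // lerD2l.
Qed.

Lemma shifting_property_inv_pow2 m (alpha : Zmers n) :
  (n <= m)%N -> shifting_property ((2 ^+ m)^-1 : R) alpha.
Proof.
move=> le_nm; apply: (shifting_property_of_card (k := 1)).
  by rewrite addn1 ltn_card_light_shift.
by rewrite mulrC ler_pdivrMr ?exprn_gt0 // mul1r ler_eXn2l ?ltr1n.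
Qed.

Lemma shifting_property_of_crossing (C : R) (sigma : n.-tuple bool) :
  0 < C -> 2 ^+ n <= C * #|crossing sigma|%:R ->
  shifting_property C^-1 (residue sigma).
Proof.
move=> C_gt0 crossing_ge.
apply: (shifting_property_of_card (card_light_crossing_le sigma n_gt0)).
by rewrite ler_pdivrMl.
Qed.

(* 156 = 6 * 26 with 26 ^ 2 >= 640: for n >= 4 / c, at least a sixth of the runs
   survives the restriction to inner positions in one class modulo 3. *)
Lemma shifting_property_many_runs (c : R) (sigma : n.-tuple bool) r :
  0 < c -> (156 / c) ^+ 2 + 4 / c <= n%:R ->
  maximal_runs sigma r -> c * n%:R <= (size r)%:R ->
  shifting_property (16 * expR ((156 / c) ^+ 2))^-1 (residue sigma).
Proof.
move=> c_gt0 n_ge runs r_ge; have c4_gt0 : 0 < 4 / c by rewrite divr_gt0.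
have A_sqr_ge0 := sqr_ge0 (156 / c).
have cn_ge : 4 <= c * n%:R by rewrite mulrC -ler_pdivrMr //; lra.
have [a a_ge] := exists_many_change_positions runs r_ge cn_ge.
apply: shifting_property_of_crossing; first by rewrite mulr_gt0 ?expR_gt0.
apply: (pow2_le_expR_card_crossing n_gt0 _ _ _ a_ge); last by lra.
  by rewrite divr_gt0.
by rewrite (_ : 156 / c * (c / 6) = 26) //; field; rewrite gt_eqF.
Qed.

End ShiftingProperty.

Theorem theorem1 (R : realType) (c : R) (hc : 0 < c) :
  exists eps : R, 0 < eps /\
    forall (n : nat) (sigma : n.-tuple bool) (r : seq (bool * nat))
           (alpha : Zmers n),
      (1 <= n)%N ->
      maximal_runs sigma r ->
      c * n%:R <= (size r)%:R ->
      alpha = residue sigma ->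
      shifting_property eps alpha.
Proof.
pose A := 156 / c; pose eps_long := (16 * expR (A ^+ 2))^-1.
pose n0 := Num.bound (A ^+ 2 + 4 / c); pose eps_short : R := (2 ^+ n0)^-1.
exists (Num.min eps_long eps_short); split.
  by rewrite lt_min !invr_gt0 mulr_gt0 ?expR_gt0 ?exprn_gt0.
move=> n sigma r _ n_gt0 runs r_ge ->; have [lt_n|le_n] := ltnP n n0.
  apply: (le_shifting_property (eps' := eps_short)).
    by rewrite ge_min lexx orbT.
  exact: shifting_property_inv_pow2 (ltnW lt_n).
apply: (le_shifting_property (eps' := eps_long)); first by rewrite ge_min lexx.
apply: shifting_property_many_runs r_ge => //.
apply: le_trans (ltW (archi_boundP _)) _; last by rewrite ler_nat.
by rewrite addr_ge0 ?sqr_ge0 // divr_ge0 // ltW.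
Qed.
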